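(* Let $f\in C^\sigma(\mathbb R^n,\mathbb R^n)$ with $n\in\mathbb N$, $\sigma\ge1$. Let $K\subset\mathbb R^n$ be a compact set which does not contain any equilibrium of $\dot x=f(x)$. Let $B\in C^0(K,\mathbb S^n)$ and $M\in C^1(K,\mathbb S^n)$ be such that both $B(x)$ and $M(x)$ are positive definite for each $x\in K$. Let $M$ satisfy $$LM(x)=-P_x^TB(x)P_x\quad\text{for all }x\in K.$$ Then there are $\Lambda,\lambda>0$ such that $v^TB(x)v\ge\lambda\|v\|^2$ and $v^TM(x)v\le\Lambda\|v\|^2$ hold for all $x\in K$ and all $v\in\mathbb R^n$. Moreover, for all $x\in K$, $$L_M(x)\le-\frac{\lambda}{2\Lambda}=:-\nu<0 .$$
   Context: $\mathbb S^n$ denotes the real symmetric $n\times n$ matrices; $\|\cdot\|$ is the Euclidean norm; $Df(x)$ is the Jacobian matrix of $f$. $C^1(K,\mathbb S^n)$ means $C^1$ on an open neighbourhood of $K$. For $f(x)\neq0$: $$P_x:=I-\frac{f(x)f(x)^T}{\|f(x)\|^2},$$ $$LM(x):=M'(x)+Df(x)^TM(x)+M(x)Df(x)-\frac{M(x)f(x)f(x)^T(Df(x)+Df(x)^T)}{\|f(x)\|^2}-\frac{(Df(x)+Df(x)^T)f(x)f(x)^TM(x)}{\|f(x)\|^2},$$ where $M'(x)$ is the matrix of orbital derivatives $(M'(x))_{ij}=(\nabla M_{ij}(x))^Tf(x)$. Further, $$L_M(x):=\max_{v\in\mathbb R^n,\ v^TM(x)v=1,\ v^Tf(x)=0}\tfrac12\,v^T\,LM(x)\,v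 .$$ *)

(* Defs.v *)
From HB Require Import structures.
From mathcomp Require Import all_boot all_order all_algebra.
From mathcomp Require Import all_classical all_reals all_analysis.

Set Implicit Arguments.
Unset Strict Implicit.
Unset Printing Implicit Defensive.

Import Order.TTheory GRing.Theory Num.Theory.
Import numFieldNormedType.Exports.

Local Open Scope classical_set_scope.
Local Open Scope ring_scope.

Definition basis_vec (R : realType) (n : nat) (k : 'I_n) : 'cV[R]_n :=
  delta_mx k 0.

(* [class_C k U g]: all iterated partial derivatives of [g] of order at most
   [k] exist and are continuous at every point of [U].  Intended for open [U]. *)
Fixpoint class_C (R : realType) (n : nat) (W : normedModType R) (k : nat)
    (U : set 'cV[R]_n) (g : 'cV[R]_n -> W) : Prop :=
  (forall x, U x -> {for x, continuous g}) /\
  match k with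
  | 0%N => True
  | k'.+1 => forall i : 'I_n,
      (forall x, U x -> derivable g x (basis_vec R i)) /\
      class_C k' U (fun x => 'D_(basis_vec R i) g x)
  end.

Definition qform (R : realType) (n : nat) (A : 'M[R]_n) (v : 'cV[R]_n) : R :=
  (v^T *m A *m v) 0 0.

(* The Euclidean norm; the library norm [`|v|] on matrices is the sup norm. *)
Definition enorm (R : realType) (n : nat) (v : 'cV[R]_n) : R :=
  Num.sqrt (\sum_i v i 0 ^+ 2).

Definition posdef (R : realType) (n : nat) (A : 'M[R]_n) : Prop :=
  forall v : 'cV[R]_n, v != 0 -> 0 < qform A v.

(* C^0(K, S^n), for a function whose values outside [K] are irrelevant *)
Definition sym_C0_on (R : realType) (n : nat) (K : set 'cV[R]_n)
    (B : 'cV[R]_n -> 'M[R]_n) : Prop :=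
  {within K, continuous B} /\ forall x, K x -> B x \is symmetricmx.

(* C^1(K, S^n), that is, C^1 on an open neighbourhood of [K] *)
Definition sym_C1_on (R : realType) (n : nat) (K : set 'cV[R]_n)
    (M : 'cV[R]_n -> 'M[R]_n) : Prop :=
  exists U : set 'cV[R]_n, [/\ open U, K `<=` U,
    forall x, U x -> M x \is symmetricmx & class_C 1 U M].

Definition equilibrium (R : realType) (n : nat)
    (f : 'cV[R]_n -> 'cV[R]_n) (x : 'cV[R]_n) : Prop := f x = 0.

(* The library's [jacobian] is stated for maps between row vectors and acts on
   the right; this is the usual matrix (d f_i / d x_j), acting on columns (see
   [Df_mul] below). *)
Definition Df (R : realType) (n : nat) (f : 'cV[R]_n -> 'cV[R]_n)
    (x : 'cV[R]_n) : 'M[R]_n :=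
  \matrix_(i, j) 'D_(basis_vec R j) (fun y => f y i 0) x.

Definition grad (R : realType) (n : nat) (g : 'cV[R]_n -> R)
    (x : 'cV[R]_n) : 'cV[R]_n :=
  \col_k 'D_(basis_vec R k) g x.

Definition orbital_deriv (R : realType) (n : nat)
    (f : 'cV[R]_n -> 'cV[R]_n) (M : 'cV[R]_n -> 'M[R]_n)
    (x : 'cV[R]_n) : 'M[R]_n :=
  \matrix_(i, j) ((grad (fun y => M y i j) x)^T *m f x) 0 0.

Definition Pmx (R : realType) (n : nat) (f : 'cV[R]_n -> 'cV[R]_n)
    (x : 'cV[R]_n) : 'M[R]_n :=
  1%:M - (enorm (f x) ^+ 2)^-1 *: (f x *m (f x)^T).

Definition LM (R : realType) (n : nat) (f : 'cV[R]_n -> 'cV[R]_n)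
    (M : 'cV[R]_n -> 'M[R]_n) (x : 'cV[R]_n) : 'M[R]_n :=
  orbital_deriv f M x + (Df f x)^T *m M x + M x *m Df f x
  - (enorm (f x) ^+ 2)^-1 *:
      (M x *m f x *m (f x)^T *m (Df f x + (Df f x)^T))
  - (enorm (f x) ^+ 2)^-1 *:
      ((Df f x + (Df f x)^T) *m f x *m (f x)^T *m M x).

Definition L_M_constraint (R : realType) (n : nat)
    (f : 'cV[R]_n -> 'cV[R]_n) (M : 'cV[R]_n -> 'M[R]_n)
    (x : 'cV[R]_n) : set 'cV[R]_n :=
  [set v | qform (M x) v = 1 /\ (v^T *m f x) 0 0 = 0].

(* Taken in the extended reals because in dimension 1 no vector is admissible
   when f(x) <> 0; the value is then -oo.  If M(x) is positive definite and
   n >= 2, some vector is admissible and the supremum is a genuine maximum: see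
   [L_M_constraint_neq0] and [L_M_max] below. *)
Definition L_M (R : realType) (n : nat) (f : 'cV[R]_n -> 'cV[R]_n)
    (M : 'cV[R]_n -> 'M[R]_n) (x : 'cV[R]_n) : \bar R :=
  ereal_sup [set (2^-1 * qform (LM f M x) v)%:E | v in L_M_constraint f M x].

Lemma symmetricmxP (R : realType) (n : nat) (A : 'M[R]_n) :
  reflect (A^T = A) (A \is symmetricmx).
Proof.
apply: (iffP (is_hermitianmxP _ _ _)) => /=.
  by rewrite expr0 scale1r map_mx_id // => {2}->.
by rewrite expr0 scale1r map_mx_id // => ->.
Qed.

Lemma continuous_trmx (R : realType) (m n : nat) :
  continuous (@trmx R m n).
Proof.
move=> A P /nbhs_ballP[e e0 eP]; apply/nbhs_ballP; exists e => // B [_ AB].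
by apply: eP; split=> // i j; rewrite !mxE; exact: AB.
Qed.

Lemma Df_mul (R : realType) (n : nat) (f : 'cV[R]_n -> 'cV[R]_n)
    (x v : 'cV[R]_n) :
  differentiable f x -> Df f x *m v = 'D_v f x.
Proof.
move=> df; apply/matrixP => i j; rewrite (ord1 j) mxE.
rewrite derive_mx ?mxE; last exact: diff_derivable.
have dfi : differentiable (fun y => f y i 0) x.
  exact: (differentiable_comp df (@differentiable_coord _ _ _ (f x) i 0)).
rewrite [RHS]deriveE//.
have -> : 'd (fun y => f y i 0) x v =
    'd (fun y => f y i 0) x (\sum_k v k 0 *: basis_vec R k).
  congr ('d _ _ _); rewrite {1}[v]matrix_sum_delta.
  by apply: eq_bigr => k _; rewrite big_ord1.
rewrite linear_sum; apply: eq_bigr => k _.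
by rewrite linearZ /= mxE deriveE// mulrC.
Qed.

Lemma continuous_sum_ord (R : realType) (m n : nat)
    (F : 'I_n -> 'cV[R]_m -> R) :
  (forall k, continuous (F k)) -> continuous (fun v => \sum_k F k v).
Proof.
move=> Fc; apply: (@continuous_big R) => [|k _]; last exact: Fc.
exact: add_continuous.
Qed.

Lemma linear_form_continuous (R : realType) (n : nat) (a : 'I_n -> R) :
  continuous (fun v : 'cV[R]_n => \sum_k v k 0 * a k).
Proof.
apply: continuous_sum_ord => k v.
exact: (cvgM (@coord_continuous R n 1 k 0 v) (cvg_cst (a k))).
Qed.

Lemma qform_continuous (R : realType) (n : nat) (A : 'M[R]_n) :
  continuous (qform A).
Proof.
have -> : qform A = fun v => \sum_k (\sum_j v j 0 * A j k) * v k 0.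
  apply/funext => v; rewrite /qform mxE; apply: eq_bigr => k _.
  by rewrite mxE; congr (_ * _); apply: eq_bigr => j _; rewrite mxE.
have sum_cont : continuous
    (fun v : 'cV[R]_n => \sum_k (\sum_j v j 0 * A j k) * v k 0).
  apply: continuous_sum_ord => k v.
  exact: (cvgM (@linear_form_continuous R n (fun j => A j k) v)
               (@coord_continuous R n 1 k 0 v)).
exact: sum_cont.
Qed.

Lemma qformZ (R : realType) (n : nat) (A : 'M[R]_n) (a : R) (v : 'cV[R]_n) :
  qform A (a *: v) = a ^+ 2 * qform A v.
Proof.
by rewrite /qform [X in X *m A]linearZ /= -scalemxAr -!scalemxAl scalerA mxE.
Qed.

Lemma cV_compact (R : realType) (n : nat) (A : set 'cV[R]_n) :
  bounded_set A -> closed A -> compact A.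
Proof.
move=> bA cA.
have -> : A = trmx @` [set u : 'rV[R]_n | A u^T].
  apply/seteqP; split => [v Av|_ [u Au <-]//].
  by exists v^T; rewrite /= trmxK.
apply: continuous_compact.
  by apply: continuous_subspaceT; exact: continuous_trmx.
have trmx_le (p q : nat) (B : 'M[R]_(p, q)) : `|B^T| <= `|B|.
  rewrite [leLHS]/Num.norm/= mx_normrE; apply/bigmax_leP; split=> //= -[i j] _.
  rewrite mxE [leRHS]/Num.norm/= mx_normrE.
  by apply/bigmax_geP; right; exists (j, i).
apply: bounded_closed_compact.
  case: bA => N [Nr bA]; exists N; split => // y Ny u /= Au.
  by apply: le_trans (bA _ Ny _ Au); rewrite -{1}[u]trmxK trmx_le.
by apply: preimage_closed => // u _; exact: continuous_trmx.
Qed.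

Lemma posdef_coercive (R : realType) (n : nat) (A : 'M[R]_n) :
  posdef A -> exists2 c : R, 0 < c & forall v, c * `|v| ^+ 2 <= qform A v.
Proof.
move=> pA; pose S := [set v : 'cV[R]_n | `|v| = 1].
have scale (v : 'cV[R]_n) : v != 0 -> S (`|v|^-1 *: v).
  move=> v0; rewrite /S /= normrZ normfV normr_id mulVf //.
  by rewrite normr_eq0.
have [S0|S0] := pselect (S !=set0); last first.
  exists 1 => // v; have [->|/scale Sv] := eqVneq v 0;
    last by case: S0; eexists; exact: Sv.
  by rewrite normr0 expr0n mulr0 /qform mulmx0 mxE.
have cS : compact S.
  apply: cV_compact.
    exists 1; split => // y y1 v /= Sv.
    by apply: le_trans (ltW y1); rewrite Sv.
  apply: (@preimage_closed _ _ (fun v : 'cV[R]_n => `|v|) [set 1]).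
    by move=> v _; exact: norm_continuous.
  exact: closed_eq.
have [|c] := @compact_EVT_min _ _ (qform A) S S0 cS.
  by apply: continuous_subspaceT; exact: qform_continuous.
rewrite inE => Sc minc; exists (qform A c).
  apply: pA; apply/eqP => c0; move: Sc.
  by rewrite c0 /S /= normr0 => /esym/eqP; rewrite oner_eq0.
move=> v; have [->|v0] := eqVneq v 0.
  by rewrite normr0 expr0n mulr0 /qform mulmx0 mxE.
have := minc _ (mem_set (scale _ v0)).
by rewrite qformZ exprVn mulrC ler_pdivlMr // exprn_gt0 // normr_gt0.
Qed.

Lemma L_M_max (R : realType) (n : nat) (f : 'cV[R]_n -> 'cV[R]_n)
    (M : 'cV[R]_n -> 'M[R]_n) (x : 'cV[R]_n) :
  posdef (M x) -> L_M_constraint f M x !=set0 ->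
  exists2 w, L_M_constraint f M x w &
    L_M f M x = (2^-1 * qform (LM f M x) w)%:E /\
    forall v, L_M_constraint f M x v ->
      2^-1 * qform (LM f M x) v <= 2^-1 * qform (LM f M x) w.
Proof.
move=> /posdef_coercive[c c0 cM] C0; set C := L_M_constraint f M x in C0 *.
have cC : compact C.
  apply: cV_compact.
    exists (1 + c^-1); split; first exact: num_real.
    move=> y yc v [/= Mv _].
    apply: le_trans (ltW yc); have := cM v; rewrite Mv.
    rewrite mulrC -ler_pdivlMr // div1r => vc.
    have [v1|/ltW v1] := leP `|v| 1.
      by rewrite (le_trans v1) // lerDl invr_ge0 ltW.
    apply: (@le_trans _ _ (c^-1)); last by rewrite lerDr.
    by apply: le_trans vc; rewrite expr2 ler_peMl.
  apply: closedI.
    apply: (@preimage_closed _ _ (qform (M x)) [set 1]); last exact: closed_eq.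
    by move=> v _; exact: qform_continuous.
  apply: (@preimage_closed _ _ (fun v : 'cV[R]_n => (v^T *m f x) 0 0) [set 0]).
    move=> v _.
    have -> : (fun v : 'cV[R]_n => (v^T *m f x) 0 0) =
        fun v => \sum_k v k 0 * f x k 0.
      by apply/funext => u; rewrite mxE; apply: eq_bigr => k _; rewrite mxE.
    exact: linear_form_continuous.
  exact: closed_eq.
have [|w] := @compact_EVT_max _ _ (qform (LM f M x)) C C0 cC.
  by apply: continuous_subspaceT; exact: qform_continuous.
rewrite inE => Cw maxw; exists w => //.
have le_w v : C v -> 2^-1 * qform (LM f M x) v <= 2^-1 * qform (LM f M x) w.
  by move=> Cv; rewrite ler_pM2l ?invr_gt0// maxw// inE.
split=> //; apply/eqP; rewrite eq_le; apply/andP; split.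
  by apply: ge_ereal_sup => _ [v Cv <-]; rewrite lee_fin; exact: le_w.
by apply: ereal_sup_ubound; exists w.
Qed.

Lemma L_M_constraint_neq0 (R : realType) (n : nat)
    (f : 'cV[R]_n -> 'cV[R]_n) (M : 'cV[R]_n -> 'M[R]_n) (x : 'cV[R]_n) :
  (1 < n)%N -> posdef (M x) -> L_M_constraint f M x !=set0.
Proof.
move=> n1 pM.
have /rowV0Pn[u /sub_kermxP uf u0] : kermx (f x) != 0.
  rewrite -mxrank_eq0 mxrank_ker subn_eq0 -ltnNge.
  exact: leq_ltn_trans (rank_leq_col _) n1.
have ut0 : u^T != 0 by rewrite trmx_eq0.
have q0 := pM _ ut0; set q := qform _ _ in q0.
exists ((Num.sqrt q)^-1 *: u^T); split.
  by rewrite qformZ exprVn sqr_sqrtr ?ltW// mulVf ?gt_eqF.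
by rewrite linearZ /= trmxK -scalemxAl uf scaler0 mxE.
Qed.

(* Main.v *)
(* If v is orthogonal to f(x), then P_x v = v, so v^T LM(x) v = - v^T B(x) v,
   which is at most - lambda |v|^2; the normalisation v^T M(x) v = 1 forces
   |v|^2 >= 1 / Lambda.  The constant lambda exists because a positive definite
   lower bound at x survives, halved, near x, and K is compact. *)
Require Import Defs.
From mathcomp Require Import all_boot all_order all_algebra.
From mathcomp Require Import all_classical all_reals all_analysis.
Import Order.TTheory GRing.Theory Num.Theory.
Import numFieldNormedType.Exports.
Local Open Scope classical_set_scope.
Local Open Scope ring_scope.

Lemma enorm_sqr (R : realType) (n : nat) (v : 'cV[R]_n) :
  enorm v ^+ 2 = \sum_i v i 0 ^+ 2.
Proof. by rewrite sqr_sqrtr// sumr_ge0// => i _; exact: sqr_ge0. Qed.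

Lemma normr_mx_entry (R : realType) (m n : nat) (A : 'M[R]_(m, n)) i j :
  `|A i j| <= `|A|.
Proof.
rewrite [leRHS]/Num.norm/= mx_normrE.
by apply/bigmax_geP; right; exists (i, j).
Qed.

Lemma norm_le_enorm (R : realType) (n : nat) (v : 'cV[R]_n) : `|v| <= enorm v.
Proof.
rewrite [leLHS]/Num.norm/= mx_normrE.
apply/bigmax_leP; split=> [|[i j] _ /=]; first exact: sqrtr_ge0.
rewrite ord1 -sqrtr_sqr ler_wsqrtr// (bigD1 i)//= lerDl sumr_ge0// => k _.
exact: sqr_ge0.
Qed.

Lemma enorm_sqr_le (R : realType) (n : nat) (v : 'cV[R]_n) :
  enorm v ^+ 2 <= n%:R * `|v| ^+ 2.
Proof.
rewrite enorm_sqr; apply: (@le_trans _ _ (\sum_(i < n) `|v| ^+ 2)).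
  apply: ler_sum => i _; rewrite -real_normK ?num_real// lerXn2r ?nnegrE//.
  exact: normr_mx_entry.
by rewrite sumr_const card_ord mulr_natl.
Qed.

Lemma qformE (R : realType) (n : nat) (A : 'M[R]_n) (v : 'cV[R]_n) :
  qform A v = \sum_k \sum_j v j 0 * A j k * v k 0.
Proof.
rewrite /qform mxE; apply: eq_bigr => k _; rewrite mxE mulr_suml.
by apply: eq_bigr => j _; rewrite mxE.
Qed.

(** The form is a sum of [n ^ 2] entrywise terms. Being linear in [A], it therefore varies with the
    matrix in a way controlled uniformly in [v]. *)
Lemma normr_qform_le (R : realType) (n : nat) (A : 'M[R]_n) (v : 'cV[R]_n) :
  `|qform A v| <= (n ^ 2)%:R * `|A| * `|v| ^+ 2.
Proof.
rewrite qformE; apply: (le_trans (ler_norm_sum _ _ _)).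
apply: (@le_trans _ _ (\sum_(k < n) \sum_(j < n) `|A| * `|v| ^+ 2)).
  apply: ler_sum => k _; apply: (le_trans (ler_norm_sum _ _ _)).
  apply: ler_sum => j _; rewrite !normrM mulrAC mulrC expr2.
  by rewrite !ler_pM ?mulr_ge0// normr_mx_entry.
by rewrite !sumr_const card_ord -mulrnA mulnn -mulrA mulr_natl.
Qed.

Lemma qformB (R : realType) (n : nat) (A B : 'M[R]_n) (v : 'cV[R]_n) :
  qform (A - B) v = qform A v - qform B v.
Proof. by rewrite /qform mulmxBr mulmxBl !mxE. Qed.

Lemma posdef_uniform_lower_bound (R : realType) (n : nat)
    (K : set 'cV[R]_n) (B : 'cV[R]_n -> 'M[R]_n) :
  compact K -> {within K, continuous B} -> (forall x, K x -> posdef (B x)) ->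
  exists2 c : R, 0 < c &
    forall x, K x -> forall v, c * enorm v ^+ 2 <= qform (B x) v.
Proof.
move=> /compact_near_coveringP/near_covering_withinP Kc.
move=> /subspace_continuousP Bc Bpos.
pose P (c : R) x := forall v, c * enorm v ^+ 2 <= qform (B x) v.
(* Compactness as near-covering replaces a finite subcover: it suffices that each [x] in [K] has
   [P d y] for all [y] in [K] close to [x] and all small [d > 0]. *)
have PK : \forall c \near 0^'+, K `<=` P c.
  apply: Kc => x Kx; have [c c0 cB] := posdef_coercive (Bpos x Kx).
  (* The two thresholds each cost [c / 2]: one for moving from [B x] to [B y], one for passing from
     the sup norm to the Euclidean norm. Successors keep the denominators nonzero when [n = 0]. *)
  have e0 : 0 < c / 2 / (n ^ 2).+1%:R by rewrite !divr_gt0.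
  have d0 : 0 < c / 2 / n.+1%:R by rewrite !divr_gt0.
  near=> y d; move=> Ky v.
  have By : `|B x - B y| < c / 2 / (n ^ 2).+1%:R.
    (* Continuity holds only within [K], so the eventual property of [y] must carry [K y] as a
       premise. *)
    suff : K y -> `|B x - B y| < c / 2 / (n ^ 2).+1%:R by exact.
    near: y; exact: (cvgr_dist_lt _ _ (Bc x Kx) _ e0).
  have dd : 0 < d < c / 2 / n.+1%:R.
    by apply/andP; split; near: d; [exact: nbhs_right_gt|exact: nbhs_right_lt].
  have -> : qform (B y) v = qform (B x) v - qform (B x - B y) v.
    by rewrite qformB subKr.
  rewrite lerBrDl; apply: le_trans (cB v).
  have -> : c * `|v| ^+ 2 = c / 2 * `|v| ^+ 2 + c / 2 * `|v| ^+ 2.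
    by rewrite -mulrDl -splitr.
  apply: lerD.
    apply: (le_trans (ler_norm _)); apply: (le_trans (normr_qform_le _ _ _ _)).
    rewrite ler_wpM2r ?sqr_ge0//.
    move: By => /ltW; rewrite ler_pdivlMr// => /(le_trans _); apply.
    by rewrite mulrC ler_wpM2l// ler_nat.
  case/andP: dd => d0' /ltW; rewrite ler_pdivlMr// => dd.
  apply: (@le_trans _ _ (d * (n%:R * `|v| ^+ 2))).
    by rewrite ler_pM2l// enorm_sqr_le.
  rewrite mulrA ler_wpM2r ?sqr_ge0//; apply: le_trans dd.
  by rewrite ler_pM2l// ler_nat.
near (0 : R)^'+ => c; exists c => //.
by near: c.
Unshelve. all: by end_near.
Qed.

(** The image of [K] under [M] is compact, hence bounded in the sup norm. *)
Lemma qform_uniform_upper_bound (R : realType) (n : nat)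
    (K : set 'cV[R]_n) (M : 'cV[R]_n -> 'M[R]_n) :
  compact K -> {within K, continuous M} ->
  exists2 C : R, 0 < C &
    forall x, K x -> forall v, qform (M x) v <= C * enorm v ^+ 2.
Proof.
move=> Kc Mc.
have [N [Nr MN]] := compact_bounded (continuous_compact Mc Kc).
(* The bound is available only strictly above [N], which may be negative; [N1] is also
   nonnegative. *)
pose N1 := `|N| + 1.
have NN1 : N < N1 by rewrite (le_lt_trans (ler_norm N))// ltrDl.
exists ((n ^ 2)%:R * N1 + 1).
  by rewrite ltr_wpDl// mulr_ge0// addr_ge0.
move=> x Kx v; apply: (le_trans (ler_norm _)).
apply: (le_trans (normr_qform_le _ _ _ _)).
apply: ler_pM; rewrite ?mulr_ge0 ?sqr_ge0//.
- have MxN : `|M x| <= N1 by apply: (MN _ NN1); exists x.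
  by rewrite (@le_trans _ _ ((n ^ 2)%:R * N1))// ?lerDl// ler_wpM2l.
- by rewrite lerXn2r ?nnegrE// ?sqrtr_ge0// norm_le_enorm.
Qed.

(** The rank-one part of [Pmx f x] annihilates [v]. *)
Lemma qform_Pmx_orthogonal (R : realType) (n : nat)
    (f : 'cV[R]_n -> 'cV[R]_n) (B : 'M[R]_n) (x v : 'cV[R]_n) :
  (v^T *m f x) 0 0 = 0 ->
  qform (- ((Pmx f x)^T *m B *m Pmx f x)) v = - qform B v.
Proof.
move=> vf.
have fv : (f x)^T *m v = 0.
  apply/trmx_inj/matrixP => i j.
  by rewrite !ord1 trmx_mul trmxK vf trmx0 mxE.
have Pv : Pmx f x *m v = v.
  by rewrite /Pmx mulmxBl mul1mx -scalemxAl -mulmxA fv mulmx0 scaler0 subr0.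
have -> : qform (- ((Pmx f x)^T *m B *m Pmx f x)) v =
    - qform B (Pmx f x *m v).
  by rewrite /qform mulmxN mulNmx mxE trmx_mul !mulmxA.
by rewrite Pv.
Qed.

Theorem proposition2p2 (R : realType) (n sigma : nat)
  (f : 'cV[R]_n -> 'cV[R]_n) (K : set 'cV[R]_n)
  (B M : 'cV[R]_n -> 'M[R]_n)
  (sigma_ge1 : (1 <= sigma)%N)
  (f_smooth : class_C sigma setT f)
  (K_compact : compact K)
  (K_no_equilibrium : forall x, K x -> ~ equilibrium f x)
  (B_C0 : sym_C0_on K B)
  (M_C1 : sym_C1_on K M)
  (B_posdef : forall x, K x -> posdef (B x))
  (M_posdef : forall x, K x -> posdef (M x))
  (LM_eq : forall x, K x ->
     LM f M x = - ((Pmx f x)^T *m B x *m Pmx f x)) :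
  exists Lambda lambda : R,
    [/\ 0 < Lambda, 0 < lambda,
        (forall x, K x -> forall v : 'cV[R]_n,
           lambda * enorm v ^+ 2 <= qform (B x) v /\
           qform (M x) v <= Lambda * enorm v ^+ 2) &
        let nu := lambda / (2 * Lambda) in
        - nu < 0 /\
        forall x, K x -> (L_M f M x <= (- nu)%:E)%E].
Proof.
have Mc : {within K, continuous M}.
  case: M_C1 => U [Uo KU _ [Mc _]]; apply/subspace_continuousP => x Kx.
  by apply: cvg_within_filter; apply: Mc; apply: KU.
have [lam lam0 Blam] :=
  posdef_uniform_lower_bound _ _ _ _ K_compact B_C0.1 B_posdef.
have [Lam Lam0 MLam] := qform_uniform_upper_bound _ _ _ _ K_compact Mc.
exists Lam, lam; split=> // [x Kx v|nu]; first by split; [exact: Blam|exact: MLam].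
(* Isolating [2^-1] lets it cancel against the factor in [L_M]. *)
have nuE : nu = 2^-1 * (lam / Lam) by rewrite /nu invfM mulrCA.
split; first by rewrite oppr_lt0 nuE mulr_gt0// divr_gt0.
(* A bound for each admissible [v] suffices, even when there is none and the supremum is [-oo]. *)
move=> x Kx; apply: ge_ereal_sup => _ [v [Mv vf] <-].
rewrite lee_fin LM_eq// qform_Pmx_orthogonal// nuE mulrN lerN2 ler_pM2l//.
apply: le_trans (Blam x Kx v); rewrite ler_pM2l// -div1r ler_pdivrMr// mulrC.
by rewrite -Mv MLam.
Qed.
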